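(* Let $p>3$ be a prime, let $e$ be a positive integer, and put $q=p^e$. Let $l\ge 0$ be an integer, and let $k$ be an integer with $0\leq k\leq p-1$ and $k\neq 0,2,4$. Let $$f(x)=(4-k)\,x^{\frac{p^l+1}{2}}+k\,x^{\frac{p^l-1}{2}}+(2-k)\,x \in \mathbb{F}_q[x].$$ Then $f(x)$ is a permutation polynomial of $\mathbb{F}_q$ if and only if $l=0$ and $k\neq 3$.
   Context: $\mathbb{F}_q$ denotes the finite field with $q=p^e$ elements. Integer coefficients are interpreted in $\mathbb{F}_q$ via reduction modulo $p$. The monomial $x^0$ is the constant polynomial $1$ (this occurs when $l=0$). A polynomial $f\in\mathbb{F}_q[x]$ is called a permutation polynomial of $\mathbb{F}_q$ if the map $\mathbb{F}_q\to\mathbb{F}_q$, $x\mapsto f(x)$, is a bijection. *)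

(* Defs.v *)
From mathcomp Require Import all_boot all_algebra.

Set Implicit Arguments.
Unset Strict Implicit.
Unset Printing Implicit Defensive.

Local Open Scope ring_scope.

Definition permutation_poly (F : finFieldType) (f : {poly F}) : Prop :=
  bijective (fun x : F => f.[x]).

(* For odd p, both halvings of exponents are exact.  The coefficients are
   computed in F, so that 4 - k is not a truncated difference. *)
Definition trinomial (F : finFieldType) (p l k : nat) : {poly F} :=
  (4%:R - k%:R) *: 'X^((p ^ l + 1) %/ 2)
  + k%:R *: 'X^((p ^ l - 1) %/ 2)
  + (2%:R - k%:R) *: 'X.

(* Main.v *)
Require Import Defs.
From mathcomp Require Import all_boot all_algebra.
From mathcomp Require Import finfield ring.

Set Implicit Arguments.
Unset Strict Implicit.
Unset Printing Implicit Defensive.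

Import GRing.Theory.

(** For [l = 0] the polynomial is the affine map [x |-> (6 - 2k) x + k], which
    is bijective exactly when [k <> 3].

    For [l > 0] permutation already fails on the prime field: the coefficients
    lie in the prime field, so [f] maps it into itself, and an injective [f]
    would permute it ([permutation_trinomial_prime_subfield]).  There
    [x ^ (p ^ l) = x], so the values [s x = x ^ ((p ^ l - 1) / 2)] satisfy
    [s x ^ 2 = 1] for [x <> 0].  Hermite's criterion in degree 2 now decides.
    If [f] is a permutation of the prime field, then the sum of all [f(x)^2]
    equals the sum of all [x^2].  Expanding [f(x)^2] with [s^2 = 1] gives, next
    to [k^2 s^2], only multiples of [x], [x^2], [s x] and [s x^2].  As [4] is a
    square, [s 4 = 1], so the substitution [x := 4 x] multiplies these
    monomials by [4] or [16].  Both factors differ from [1] when [p > 5], hence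
    all the sums vanish ([sum_eigen_eq0]), and what remains is [- k^2 = 0],
    which is absurd ([trinomial_not_injective_gt5]).  For [p = 5] the factor
    [16] is [1], but only [k = 1] and [k = 3] are possible, and each has a
    collision among [0], [1] and [4]. *)

Local Open Scope ring_scope.

(** * Evaluation and restriction to the prime field *)

Lemma horner_trinomial (F : finFieldType) (p l k : nat) (x : F) :
  (trinomial F p l k).[x] =
  (4%:R - k%:R) * x ^+ ((p ^ l + 1) %/ 2)
  + k%:R * x ^+ ((p ^ l - 1) %/ 2) + (2%:R - k%:R) * x.
Proof. by rewrite /trinomial !(hornerD, hornerZ, hornerXn, hornerX). Qed.

Lemma horner_trinomial_rmorph (K F : finFieldType) (h : {rmorphism K -> F})
    (p l k : nat) (x : K) :
  (trinomial F p l k).[h x] = h (trinomial K p l k).[x].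
Proof.
by rewrite !horner_trinomial !(rmorph_nat, rmorphD, rmorphM, rmorphN, rmorphXn).
Qed.

(** The coefficients are integers, so evaluation commutes with the embedding
    of ['F_p] into [F], and injectivity descends along it. *)
Lemma permutation_trinomial_prime_subfield (F : finFieldType) (p l k : nat) :
  p \in [pchar F] -> permutation_poly (trinomial F p l k) ->
  injective (fun x : 'F_p => (trinomial 'F_p p l k).[x]).
Proof.
move=> charFp /bij_inj injf x y /= eqfxy.
pose h : {rmorphism 'F_p -> pPrimeCharType charFp} := in_alg _.
have hE z : (trinomial F p l k).[h z] = h (trinomial 'F_p p l k).[z].
  exact: (horner_trinomial_rmorph h).
by apply: (fmorph_inj h); apply: injf; rewrite /= !hE eqfxy.
Qed.

(** * Power sums *)

(** The substitution [x := c x] permutes the field and multiplies the sum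
    by [a]. *)
Lemma sum_eigen_eq0 (K : finFieldType) (c a : K) (g : K -> K) :
  c != 0 -> a != 1 -> (forall x, g (c * x) = a * g x) -> \sum_x g x = 0.
Proof.
move=> c0 a1 gc.
have Esum : \sum_x g x = a * \sum_x g x.
  rewrite {1}(reindex_inj (mulfI c0)) mulr_sumr.
  by apply: eq_bigr => x _; apply: gc.
apply/eqP; have /eqP := Esum.
by rewrite -subr_eq0 -{1}[\sum_x g x]mul1r -mulrBl mulf_eq0 subr_eq0 eq_sym
  (negPf a1).
Qed.

Section PrimeField.

Variables (K : finFieldType) (p l : nat).
Hypotheses (p_pr : prime p) (p_gt3 : (3 < p)%N) (cardK : #|K| = p)
  (l_gt0 : (0 < l)%N).

Local Notation m := ((p ^ l - 1) %/ 2)%N.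

Let charK : p \in [pchar K].
Proof. by apply: (@card_finPcharP _ _ 1). Qed.

Let natr_eq0 n : (n%:R == 0 :> K) = (p %| n)%N.
Proof. by rewrite (dvdn_pcharf charK). Qed.

Let p_odd : odd p.
Proof. by have [p2|//] := even_prime p_pr; move: p_gt3; rewrite p2. Qed.

Let pXl_gt1 : (1 < p ^ l)%N.
Proof. by rewrite -(exp1n l) ltn_exp2r // prime_gt1. Qed.

Let pXlE : (p ^ l = (m.*2).+1)%N.
Proof.
have odd_pXl : odd (p ^ l) by rewrite oddX p_odd orbT.
rewrite divn2 subn1; have := odd_double_half (p ^ l).-1.
rewrite -[in odd _](ltn_predK pXl_gt1) /= in odd_pXl.
by rewrite (negPf odd_pXl) add0n => ->; rewrite (ltn_predK pXl_gt1).
Qed.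

Let half_succE : ((p ^ l + 1) %/ 2 = m.+1)%N.
Proof. by rewrite [in LHS]pXlE addn1 -doubleS divn2 doubleK. Qed.

Let half_gt0 : (0 < m)%N.
Proof. by have := pXl_gt1; rewrite {1}pXlE; case: m. Qed.

Lemma prime_field_frobenius_iter (x : K) : x ^+ (p ^ l) = x.
Proof.
elim: l => [|j IHj]; first by rewrite expr1.
by rewrite expnSr exprM IHj -cardK expf_card.
Qed.

Lemma half_power_sqr_mul (x : K) : (x ^+ m) ^+ 2 * x = x.
Proof.
by rewrite -exprM muln2 -exprSr -pXlE prime_field_frobenius_iter.
Qed.

Lemma half_power_sqr (x : K) : (x ^+ m) ^+ 2 = (x != 0)%:R.
Proof.
have [->|x0] := eqVneq x 0.
  by rewrite -exprM expr0n muln2 eqn0Ngt double_gt0 half_gt0.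
by apply: (mulIf x0); rewrite half_power_sqr_mul mul1r.
Qed.

Lemma two_neq0 : 2%:R != 0 :> K.
Proof.
by rewrite natr_eq0; apply/negP => /dvdn_leq/(leq_trans p_gt3) => /(_ isT).
Qed.

Lemma four_neq0 : 4%:R != 0 :> K.
Proof. by rewrite (natrM _ 2 2) mulf_neq0 ?two_neq0. Qed.

Lemma three_neq0 : 3%:R != 0 :> K.
Proof.
by rewrite natr_eq0; apply/negP => /dvdn_leq/(leq_trans p_gt3) => /(_ isT).
Qed.

Lemma four_neq1 : 4%:R != 1 :> K.
Proof. by rewrite -subr_eq0 -[1]/(1%:R) -natrB // three_neq0. Qed.

Lemma half_power_four : 4%:R ^+ m = 1 :> K.
Proof. by rewrite (natrM _ 2 2) exprMn -expr2 half_power_sqr two_neq0. Qed.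

Lemma sum_half_power_sqr : \sum_(x : K) (x ^+ m) ^+ 2 = -1.
Proof.
rewrite (bigD1 0) //= half_power_sqr eqxx add0r.
rewrite (eq_bigr (fun=> 1)) => [|x x0]; last by rewrite half_power_sqr x0.
rewrite sumr_const.
have -> : #|[pred x : K | x != 0]| = p.-1 by rewrite -cardK (cardC1 (0 : K)).
apply/eqP; rewrite -addr_eq0 -mulrSr prednK ?prime_gt0 //.
by rewrite natr_eq0.
Qed.

Lemma horner_trinomial_half_power k (x : K) :
  (trinomial K p l k).[x] =
  x ^+ m * ((4%:R - k%:R) * x + k%:R) + (2%:R - k%:R) * x.
Proof. by rewrite horner_trinomial half_succE exprS; ring. Qed.

(** * Non-injectivity on the prime field *)

(** Hermite's criterion in degree 2: an injective [f] would preserve the sum of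
    all squares, which is [0], while the expansion of [f(x)^2] has total
    [- k^2]. *)
Lemma trinomial_not_injective_gt5 k :
  (p != 5)%N -> k%:R != 0 :> K ->
  ~ injective (fun x : K => (trinomial K p l k).[x]).
Proof.
move=> p5 k0 injf.
have sixteen_neq1 : 4%:R ^+ 2 != 1 :> K.
  rewrite -natrX -subr_eq0 -[1]/(1%:R) -natrB //.
  rewrite natr_eq0 (_ : 4 ^ 2 - 1 = 3 * 5)%N // Euclid_dvdM //.
  by rewrite !dvdn_prime2 // (negPf p5) orbF gtn_eqF.
have sum_sqr : \sum_(x : K) x ^+ 2 = 0.
  apply: (sum_eigen_eq0 four_neq0 sixteen_neq1) => x.
  by rewrite exprMn.
set a : K := 4%:R - k%:R; set b : K := 2%:R - k%:R.
(* The parts of the square of f of degree 1 and 2 in x, the sign s being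
   counted in degree 0. *)
pose g1 (x : K) := (a * k%:R + b * k%:R * x ^+ m) * x *+ 2.
pose g2 (x : K) := (a ^+ 2 + b ^+ 2 + (a * b * x ^+ m) *+ 2) * x ^+ 2.
have sum_g1 : \sum_x g1 x = 0.
  apply: (sum_eigen_eq0 four_neq0 four_neq1) => x.
  by rewrite /g1 exprMn half_power_four; ring.
have sum_g2 : \sum_x g2 x = 0.
  apply: (sum_eigen_eq0 four_neq0 sixteen_neq1) => x.
  by rewrite /g2 exprMn half_power_four; ring.
have f_sqr (x : K) :
    (trinomial K p l k).[x] ^+ 2 = g1 x + g2 x + k%:R ^+ 2 * (x ^+ m) ^+ 2.
  rewrite horner_trinomial_half_power -/a -/b /g1 /g2.
  have := half_power_sqr_mul x; move: (x ^+ m) => s s2x.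
  have s2x2 : s ^+ 2 * x ^+ 2 = x ^+ 2 by rewrite (expr2 x) mulrA s2x.
  transitivity (a ^+ 2 * (s ^+ 2 * x ^+ 2) + (a * k%:R * (s ^+ 2 * x)) *+ 2
    + k%:R ^+ 2 * s ^+ 2 + (a * b * s * x ^+ 2 + b * k%:R * s * x) *+ 2
    + b ^+ 2 * x ^+ 2); first by ring.
  by rewrite s2x s2x2; ring.
clearbody g1 g2; have := sum_sqr.
rewrite (reindex_inj injf) (eq_bigr _ (fun x _ => f_sqr x)).
rewrite !big_split /= sum_g1 sum_g2 !add0r -mulr_sumr sum_half_power_sqr.
by move/eqP; rewrite mulrN1 oppr_eq0 expf_eq0 (negPf k0).
Qed.

Lemma trinomial_one k : (trinomial K p l k).[1] = 6%:R - k%:R.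
Proof. by rewrite horner_trinomial_half_power expr1n; ring. Qed.

Lemma trinomial_zero k : (trinomial K p l k).[0] = 0.
Proof.
rewrite horner_trinomial_half_power expr0n eqn0Ngt half_gt0.
by rewrite mul0r mulr0 addr0.
Qed.

(** On the nonzero squares [s = 1], so [f] coincides there with
    [(6 - 2k) x + k], which is constant for [k = 3]; [1] and [4] are two such
    squares. *)
Lemma trinomial3_not_injective :
  ~ injective (fun x : K => (trinomial K p l 3).[x]).
Proof.
move=> injf; have /eqP := four_neq1; apply; apply: injf => /=.
by rewrite trinomial_one horner_trinomial_half_power half_power_four; ring.
Qed.

Lemma trinomial_not_injective k :
  (k <= p - 1)%N -> k <> 0%N -> k <> 2%N -> k <> 4%N ->
  ~ injective (fun x : K => (trinomial K p l k).[x]).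
Proof.
move=> kp k0 k2 k4; have [p5|p5] := eqVneq p 5%N; last first.
  apply: trinomial_not_injective_gt5; rewrite // natr_eq0; apply/negP.
  move/dvdn_leq; rewrite lt0n => /(_ (introN eqP k0)).
  by rewrite leqNgt (leq_ltn_trans kp) // subn1 ltn_predL prime_gt0.
have [k3|k3] := eqVneq k 3%N.
  by rewrite k3; apply: trinomial3_not_injective.
have k1 : k = 1%N.
  by move: kp k0 k2 k4 k3; rewrite p5 {p5}; case: k => [|[|[|[|[|k]]]]].
(* f(1) = 6 - 1 vanishes in characteristic 5. *)
move=> injf; have /eqP := oner_neq0 K; apply; apply: injf => /=.
rewrite trinomial_one trinomial_zero k1; apply/eqP.
by rewrite -[1%:R]/(1%:R) -natrB // natr_eq0 p5.
Qed.

End PrimeField.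

(** * The affine case *)

Lemma horner_trinomial0 (F : finFieldType) (p k : nat) (x : F) :
  (trinomial F p 0 k).[x] = (3%:R - k%:R) * 2%:R * x + k%:R.
Proof. by rewrite horner_trinomial expn0 /=; ring. Qed.

Lemma eqr_nat_pchar_lt (R : nzRingType) (p m n : nat) :
  p \in [pchar R] -> (m < p)%N -> (n < p)%N -> (m%:R == n%:R :> R) = (m == n).
Proof.
move=> charR; wlog le_nm : m n / (n <= m)%N => [IH | mp _].
  by case/orP: (leq_total n m) => /IH E mp np;
    [rewrite E | rewrite eq_sym E // eq_sym].
apply/eqP/eqP=> [/eqP|->//].
rewrite -subr_eq0 -natrB // -(dvdn_pcharf charR) => dvd_p_mn.
apply/eqP; rewrite eqn_leq le_nm andbT -subn_eq0 -leqn0 leqNgt.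
apply/negP => /dvdn_leq/(_ dvd_p_mn).
by rewrite leqNgt (leq_ltn_trans (leq_subr n m)).
Qed.

Lemma permutation_trinomial0 (F : finFieldType) (p k : nat) :
  2%:R != 0 :> F ->
  permutation_poly (trinomial F p 0 k) <-> 3%:R != k%:R :> F.
Proof.
move=> two_neq0; split=> [/bij_inj injf | k3].
  apply/eqP => k3; have /eqP := oner_neq0 F; apply; apply: injf => /=.
  by rewrite !horner_trinomial0 k3 subrr !mul0r.
apply: injF_bij => x y /=; rewrite !horner_trinomial0 => /addIr/mulfI; apply.
by rewrite mulf_neq0 // subr_eq0.
Qed.

Local Close Scope ring_scope.

Theorem theorem3p1 (p e : nat) (F : finFieldType) (l k : nat)
    (hp : prime p) (hp3 : 3 < p) (he : 0 < e) (hF : #|F| = p ^ e)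
    (hkp : k <= p - 1) (hk0 : k <> 0) (hk2 : k <> 2) (hk4 : k <> 4) :
  permutation_poly (trinomial F p l k) <-> l = 0 /\ k <> 3.
Proof.
have charF : p \in [pchar F]%R by apply: (card_finPcharP hF hp).
have ltkp : k < p by rewrite (leq_ltn_trans hkp) // subn1 ltn_predL prime_gt0.
have [-> | l_gt0] := posnP l; last first.
  split=> [/(permutation_trinomial_prime_subfield charF) injf | [l0 _]].
    by case: (trinomial_not_injective hp hp3 (card_Fp hp) l_gt0 hkp).
  by rewrite l0 in l_gt0.
have two_neq0 : (2%:R != 0 :> F)%R.
  by rewrite -(dvdn_pcharf charF) gtnNdvd // ltnW.
have natr_eq3 : (3%:R == k%:R :> F)%R = (3 == k).
  by rewrite (eqr_nat_pchar_lt charF).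
rewrite permutation_trinomial0 // natr_eq3 eq_sym.
by split=> [/eqP | [_ /eqP]].
Qed.
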